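(* Let $\zeta$ be the Riemann zeta function, $\sigma_0>1$ and $n\in\mathbb{N}$. Then there exists a relatively dense set of real numbers $\{t_{n,m}\}_{m\geq 1}$ such that, for each $m=1,2,\ldots$, the parametrized curve traced by the points $(\operatorname{Re}(\zeta(\sigma+it_{n,m})),\operatorname{Im}(\zeta(\sigma+it_{n,m})))$, with $\sigma\in(1,\sigma_0)$, makes at least $n$ turns around the origin.
   Context: A set $T\subset\mathbb{R}$ is relatively dense if there is $L>0$ such that every interval of length $L$ contains a point of $T$. For a continuous curve $\gamma:I\to\mathbb{C}\setminus\{0\}$ on an open interval $I$, with a continuous choice of argument $\varphi:I\to\mathbb{R}$ (so $\gamma=|\gamma|e^{i\varphi}$), the curve makes at least $n$ turns around the origin if there are $\sigma_1,\sigma_2\in I$ with $|\varphi(\sigma_1)-\varphi(\sigma_2)|\ge 2\pi n$. (Recall that $\zeta(s)\neq0$ for $\operatorname{Re}s>1$.) *)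

(* Defs.v *)
From HB Require Import structures.
From mathcomp Require Import all_boot all_order all_algebra.
From mathcomp Require Import all_classical all_reals all_analysis.
From mathcomp Require Import complex.
Set Implicit Arguments.
Unset Strict Implicit.
Unset Printing Implicit Defensive.
Import Order.TTheory GRing.Theory Num.Theory.
Import numFieldNormedType.Exports.
Local Open Scope classical_set_scope.
Local Open Scope ring_scope.
Local Open Scope complex_scope.

Definition cexp (R : realType) (z : R[i]) : R[i] :=
  (expR (complex.Re z) * cos (complex.Im z)) +i*
  (expR (complex.Re z) * sin (complex.Im z)).

(* The Dirichlet series sum_(k >= 1) k^-s, with k^-s = exp (- s ln k). It is
   the Riemann zeta function for Re s > 1 only; elsewhere the value of limn is
   not meaningful. The topology on complex numbers is carried by R[i]^o. *)
Definition zeta (R : realType) (s : R[i]) : R[i]^o :=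
  limn (series (fun k : nat => cexp (- s * (ln k.+1%:R)%:C) : R[i]^o)).

Definition relatively_dense (R : realType) (T : set R) : Prop :=
  exists2 L : R, 0 < L & forall a : R, (`]a, a + L[ `&` T) !=set0.

(* Meant for an open interval I, where {in I, continuous _} is continuity on I.
   The choice of phi is immaterial: two continuous arguments differ by a
   constant. *)
Definition makes_turns (R : realType) (I : interval R) (gamma : R -> R[i]^o)
    (n : nat) : Prop :=
  [/\ {in I, continuous gamma},
      {in I, forall sigma, gamma sigma != 0} &
      exists phi : R -> R,
        [/\ {in I, continuous phi},
            {in I, forall sigma,
              gamma sigma = `|gamma sigma| * cexp (0 +i* phi sigma)} &
            exists sigma1 sigma2 : R,
              [/\ sigma1 \in I, sigma2 \in I &
                  2 * pi * n%:R <= `|phi sigma1 - phi sigma2|]]].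

(* Main.v *)
(* The continuous argument of zeta (s + it) is, by the Euler product, the sum
   over primes of the arguments of the factors (1 - p^-(s + it))^-1, which
   equals - sum_p p^-s sin (t ln p) up to an error bounded uniformly in s > 1
   and t. Since sum_p 1/p diverges, its variation in s between a fixed point and
   a point close to 1 is large for every t at which all the sin (t ln p), p < N,
   lean towards -1. To find such t in every interval of a fixed length, multiply
   the trigonometric polynomial - sum_p w_p sin (t ln p) by the nonnegative Riesz
   product prod_p (1 - sin (t ln p)): by unique factorization the product has
   mean value (sum_p w_p) / 2, while the Riesz product itself has mean value 1. *)

Require Import Defs.
From HB Require Import structures.
From mathcomp Require Import all_boot all_order all_algebra.
From mathcomp Require Import all_classical all_reals all_analysis.
From mathcomp Require Import complex.
From mathcomp Require Import ring lra.
Set Implicit Arguments.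
Unset Strict Implicit.
Unset Printing Implicit Defensive.
Import Order.TTheory GRing.Theory Num.Theory.
Import numFieldNormedType.Exports.
Local Open Scope classical_set_scope.
Local Open Scope ring_scope.
Local Open Scope complex_scope.

(** * Mean values of trigonometric polynomials *)

(** Stronger than convergence of the averages: the primitive stays within bounded distance of
    [m * t]. The error over an interval is thus bounded independently of its position, which is what
    relative density needs. *)
Definition has_mean (R : realType) (f : R -> R) (m : R) : Prop :=
  exists (Q : R -> R) (B : R),
    (forall t : R, is_derive t (1 : R) Q (f t)) /\ forall t, `|Q t - m * t| <= B.

Section Mean.
Variable R : realType.
Implicit Types (f g : R -> R) (m c t : R).

Lemma has_mean_cst c : has_mean (fun=> c) c.
Proof.
exists (fun t => c * t), 0; split=> [t|t]; last by rewrite subrr normr0.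
by apply: (is_derive_eq (is_deriveZ c (is_derive_id t 1))); rewrite /GRing.scale /= mulr1.
Qed.

Lemma has_meanD f g m c :
  has_mean f m -> has_mean g c -> has_mean (fun t => f t + g t) (m + c).
Proof.
move=> [Q [B [dQ bQ]]] [Q' [B' [dQ' bQ']]].
exists (fun t => Q t + Q' t), (B + B'); split=> t.
  exact: (is_deriveD (dQ t) (dQ' t)).
have -> : Q t + Q' t - (m + c) * t = (Q t - m * t) + (Q' t - c * t) by ring.
by rewrite (le_trans (ler_normD _ _)) ?lerD.
Qed.

Lemma has_meanZ c f m : has_mean f m -> has_mean (fun t => c * f t) (c * m).
Proof.
move=> [Q [B [dQ bQ]]].
exists (fun t => c * Q t), (`|c| * B); split=> t.
  exact: (is_deriveZ c (dQ t)).
have -> : c * Q t - c * m * t = c * (Q t - m * t) by ring.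
by rewrite normrM ler_wpM2l.
Qed.

Lemma eq_has_mean f g m c : f =1 g -> m = c -> has_mean f m -> has_mean g c.
Proof. by move=> /funext -> ->. Qed.

Lemma has_mean_sum (I : Type) (r : seq I) (F : I -> R -> R) (M : I -> R)
    (P : pred I) :
  (forall i, P i -> has_mean (F i) (M i)) ->
  has_mean (fun t => \sum_(i <- r | P i) F i t) (\sum_(i <- r | P i) M i).
Proof.
move=> FM; elim: r => [|i r IH].
  apply: eq_has_mean (has_mean_cst 0) => [t|]; by rewrite big_nil.
have [Pi|Pi] := boolP (P i).
  by apply: eq_has_mean (has_meanD (FM i Pi) IH) => [t|]; rewrite big_cons Pi.
by apply: eq_has_mean IH => [t|]; rewrite big_cons (negbTE Pi).
Qed.

Lemma has_mean_cos (w u : R) : w != 0 -> has_mean (fun t => cos (t * w + u)) 0.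
Proof.
move=> w0; exists (fun t => w^-1 * sin (t * w + u)), `|w^-1|; split=> t.
  have dl : is_derive t (1 : R) (fun x : R => x * w + u) w.
    rewrite (_ : (fun _ => _) = (w \*: id) + cst u); last first.
      by apply/funext => x /=; rewrite fctE /= [w *: x]mulrC.
    by apply: is_derive_eq; rewrite addr0 /GRing.scale /= mulr1.
  have ds := @is_derive1_comp R (@sin R) _ t _ _ (is_derive_sin (t * w + u)) dl.
  apply: (is_derive_eq (is_deriveZ w^-1 ds)).
  by rewrite /GRing.scale /= mulrA mulrAC mulVf ?mul1r.
rewrite mul0r subr0 normrM ler_piMr// ler_norml.
by rewrite sin_geN1 sin_le1.
Qed.

(* By the mean value theorem applied to the primitive. *)
Lemma has_mean_gt0 f m : has_mean f m -> 0 < m ->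
  exists2 L : R, 0 < L & forall a, exists2 t, t \in `]a, a + L[ & 0 < f t.
Proof.
move=> [Q [B [dQ bQ]]] m0.
have B0 : 0 <= B by apply: le_trans (bQ 0).
(* Over a length [L], [Q] grows by at least [m * L - 2 * B]; this [L] makes that equal to 1. *)
exists ((B *+ 2 + 1) / m) => [|a]; first by rewrite divr_gt0// ltr_wpDl// mulrn_wge0.
set L := _ / m.
have L0 : 0 < L by rewrite divr_gt0// ltr_wpDl// mulrn_wge0.
have aL : a < a + L by rewrite ltrDl.
have cQ : {within `[a, a + L], continuous Q}.
  apply: continuous_subspaceT => x.
  by apply/differentiable_continuous/derivable1_diffP; have [] := dQ x.
have [t taL QE] := MVT aL (fun x _ => dQ x) cQ.
exists t => //.
have := bQ a; have := bQ (a + L); rewrite !ler_norml => /andP[h1 h2] /andP[h3 h4].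
have mL : m * L = B *+ 2 + 1 by rewrite /L mulrC divfK// gt_eqF.
have : 0 < f t * L.
  have -> : f t * L = Q (a + L) - Q a by rewrite QE; congr (_ * _); ring.
  rewrite mulr2n in mL.
  have e : m * (a + L) = m * a + m * L by rewrite mulrDr.
  rewrite e in h1 h2; lra.
by rewrite pmulr_lgt0.
Qed.

End Mean.

(** * Riesz products over primes *)

Definition riesz (R : realType) (ps : seq nat) (t : R) : R :=
  \prod_(p <- ps) (1 - sin (t * ln p%:R)).

Section Riesz.
Variable R : realType.
Implicit Types (t : R) (ps : seq nat).

Lemma riesz_ge0 ps t : 0 <= riesz ps t.
Proof. by apply: prodr_ge0 => p _; rewrite subr_ge0 sin_le1. Qed.

Lemma ln_nat_inj (a b : nat) : (0 < a)%N -> (0 < b)%N ->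
  ln a%:R = ln b%:R :> R -> a = b.
Proof.
move=> a0 b0 /(@ln_inj R) /eqP; rewrite eqr_nat => h; apply/eqP/h;
  by rewrite posrE ltr0n.
Qed.

(* A frequency [ln (a / b)] in which the prime [q] occurs cannot be cancelled
   by a product over primes different from [q]. *)
Lemma has_mean_cos_riesz ps (q a b : nat) (u : R) :
  all prime ps -> prime q -> q \notin ps -> (0 < a)%N -> (0 < b)%N ->
  logn q a != logn q b ->
  has_mean (fun t => cos (t * (ln a%:R - ln b%:R) + u) * riesz ps t) 0.
Proof.
move=> + qP; elim: ps a b u => [|p ps IH] a b u /=.
  move=> _ _ a0 b0 ab.
  (* For the empty product the frequency is nonzero, since [a] and [b] differ in their [q]-adic
     valuation. *)
  apply: eq_has_mean (@has_mean_cos R (ln a%:R - ln b%:R) u _) => // [t|].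
    by rewrite /riesz big_nil mulr1.
  rewrite subr_eq0; apply: contra ab => /eqP /ln_nat_inj ->//.
move=> /andP[pP psP]; rewrite inE negb_or => /andP[qp qps] a0 b0 ab.
have p0 := prime_gt0 pP.
have lp : logn q p = 0%N by rewrite logn_prime//; case: eqP qp => // ->; rewrite eqxx.
have h1 := IH a b u psP qps a0 b0 ab.
(* The factor [1 - sin (t * ln p)] splits the cosine by product-to-sum: frequencies move to
   [ln (a p / b)] and [ln (a / (b p))], with a shift by [pi / 2] turning sine into cosine. As [p]
   differs from [q], the valuations at [q] are unchanged. *)
have h2 := IH (a * p)%N b (u - pi / 2) psP qps.
have h3 := IH a (b * p)%N (u - pi / 2) psP qps.
rewrite !muln_gt0 !lognM// lp !addn0 a0 b0 p0 in h2 h3.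
have {}h2 := has_meanZ (- (1 / 2)) (h2 isT isT ab).
have {}h3 := has_meanZ (1 / 2) (h3 isT isT ab).
apply: eq_has_mean (has_meanD (has_meanD h1 h2) h3) => [t|]; last by rewrite !mulr0 !addr0.
rewrite !natrM !lnM ?posrE ?ltr0n//.
rewrite {4}/riesz big_cons -/(riesz ps t).
set A := ln a%:R; set B := ln b%:R; set P := ln p%:R; set K := riesz ps t.
have -> : t * (A + P - B) + (u - pi / 2) = ((t * (A - B) + u) + t * P) - pi / 2 by ring.
have -> : t * (A - (B + P)) + (u - pi / 2) = ((t * (A - B) + u) - t * P) - pi / 2 by ring.
rewrite !cosBpihalf.
set X := t * (A - B) + u.
rewrite sinD sinB; by field.
Qed.

Lemma has_mean_sin_riesz_notin ps (q : nat) : all prime ps -> prime q -> q \notin ps ->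
  has_mean (fun t => sin (t * ln q%:R) * riesz ps t) 0.
Proof.
move=> psP qP qps.
have := @has_mean_cos_riesz ps q q 1 (- (pi / 2)) psP qP qps (prime_gt0 qP) isT.
rewrite logn1 logn_prime// eqxx => /(_ isT); apply: eq_has_mean => // t.
by rewrite ln1 subr0 cosBpihalf.
Qed.

Lemma has_mean_riesz ps : all prime ps -> uniq ps -> has_mean (@riesz R ps) 1.
Proof.
elim: ps => [|p ps IH] /=.
  by move=> _ _; apply: eq_has_mean (has_mean_cst 1) => // t; rewrite /riesz big_nil.
move=> /andP[pP psP] /andP[pps ups].
apply: eq_has_mean (has_meanD (IH psP ups)
  (has_meanZ (-1) (has_mean_sin_riesz_notin psP pP pps))) => [t|]; last by rewrite mulr0 addr0.
by rewrite /riesz big_cons; ring.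
Qed.

(** Isolate the factor of [q] and use [sin x * (1 - sin x) = sin x - 1/2 + cos (2 x) / 2]. Only the
    constant survives: the other two terms have frequencies [ln q] and [ln (q * q)], which the
    remaining primes cannot cancel. *)
Lemma has_mean_sin_riesz_in ps (q : nat) : all prime ps -> uniq ps -> q \in ps ->
  has_mean (fun t => sin (t * ln q%:R) * riesz ps t) (- (1 / 2)).
Proof.
move=> psP ups qps.
have qP : prime q by apply: (allP psP).
have qr : q \notin rem q ps by rewrite mem_rem_uniq// inE eqxx.
have rP : all prime (rem q ps) by apply/allP => x /mem_rem /(allP psP).
have h1 := has_mean_sin_riesz_notin rP qP qr.
have h2 := has_mean_riesz rP (rem_uniq q ups).
have h3 := @has_mean_cos_riesz (rem q ps) q (q * q) 1 0 rP qP qr.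
have q0 := prime_gt0 qP.
have {}h3 : has_mean (fun t => cos (t * (ln (q * q)%:R - ln 1%:R) + 0) *
    riesz (rem q ps) t) 0.
  by apply: h3; rewrite ?muln_gt0 ?q0// logn1 lognM// logn_prime// eqxx.
apply: eq_has_mean (has_meanD h1 (has_meanD (has_meanZ (- (1/2)) h2)
  (has_meanZ (1/2) h3))) => [t|]; last by ring.
rewrite /riesz [in RHS](big_rem q)//= -/(riesz _ t).
rewrite natrM lnM ?posrE ?ltr0n ?prime_gt0// ln1 subr0 addr0 mulrDr -/(riesz _ t).
rewrite cosD.
have := cos2Dsin2 (t * ln q%:R).
set s := sin _; set c := cos _; set K := riesz _ _ => e.
have -> : c * c = 1 - s ^+ 2 by rewrite -e; ring.
by field.
Qed.

(* Integrating against a Riesz product picks out a sign pattern of all the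
   sines at once; this replaces Kronecker's theorem. *)
Lemma sin_sum_large ps (w : nat -> R) (c : R) : all prime ps -> uniq ps ->
  c < 1 / 2 * \sum_(p <- ps) w p ->
  exists2 L : R, 0 < L & forall a, exists2 t, t \in `]a, a + L[ &
    c < - \sum_(p <- ps) w p * sin (t * ln p%:R).
Proof.
move=> psP ups cw.
(* The Riesz product is nonnegative, so wherever this product is positive its first factor is
   positive too. *)
have : has_mean (fun t => (- (\sum_(p <- ps) w p * sin (t * ln p%:R)) - c) * riesz ps t)
    (1 / 2 * (\sum_(p <- ps) w p) - c).
  have h p : p \in ps -> has_mean (fun t => - w p * (sin (t * ln p%:R) * riesz ps t))
      (- w p * (- (1 / 2))).
    by move=> pps; exact: has_meanZ (has_mean_sin_riesz_in psP ups pps).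
  have h1 := has_mean_sum ps h.
  have h2 := has_meanZ (- c) (has_mean_riesz psP ups).
  apply: eq_has_mean (has_meanD h1 h2) => [t|].
    rewrite -big_seq mulrBl !mulNr mulr_suml -sumrN; congr (_ - _).
    by apply: eq_bigr => p _; rewrite mulNr mulrA.
  rewrite mulr1 mulr_sumr; congr (_ - _).
  by rewrite [RHS]big_seq; apply: eq_bigr => p _; rewrite mulrNN mulrC.
move=> /has_mean_gt0; rewrite subr_gt0 => /(_ cw)[L L0 hL].
exists L => // a; have [t taL ht] := hL a; exists t => //.
rewrite -subr_gt0; move: ht; have := riesz_ge0 ps t; rewrite le_eqVlt => /orP[/eqP <-|K0].
  by rewrite mulr0 ltxx.
by rewrite pmulr_lgt0.
Qed.

End Riesz.

(** * Sieving by small primes *)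

(** The numbers that survive sieving by all primes below [j]. Since [primes 0] is empty, 0 passes as
    well, whence the positivity conditions below. *)
Definition rough (j n : nat) : bool := all (leq j) (primes n).

Lemma rough0 n : rough 0 n. Proof. exact/allP. Qed.

Lemma roughS j n : (0 < n)%N ->
  rough j.+1 n = rough j n && ~~ (prime j && (j %| n)%N).
Proof.
move=> n0; apply/allP/andP => [h|[/allP h jn] p pn].
  split; first by apply/allP => p /h /ltnW.
  apply/negP => jn; have : j \in primes n by rewrite mem_primes n0; case/andP: jn => ->.
  by move/h; rewrite ltnn.
rewrite ltn_neqAle h// andbT; apply: contra jn => /eqP ->.
by move: pn; rewrite mem_primes n0.
Qed.

Lemma roughM j m : prime j -> (0 < m)%N -> rough j (j * m) = rough j m.
Proof.
move=> jP m0; have j0 := prime_gt0 jP; apply/allP/allP => h p.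
  by move=> pm; apply: h; rewrite primesM// pm orbT.
by rewrite primesM// primes_prime// inE => /orP[/eqP ->//|/h].
Qed.

(** The least prime factor of [n] is at least [j] and at most [n]. So 1 is the only positive
    [j]-rough number below [j]. *)
Lemma rough_leq j n : (1 < n)%N -> rough j n -> (j <= n)%N.
Proof.
move=> n1 /allP h; apply: leq_trans (pdiv_leq (ltnW n1)).
by apply: h; rewrite mem_primes pdiv_prime// pdiv_dvd ltnW.
Qed.

Lemma rough1 j : rough j 1. Proof. exact/allP. Qed.

Lemma big_dvdn (V : nmodType) (j : nat) (P : pred nat) (F : nat -> V) N : (0 < j)%N ->
  \sum_(1 <= n < N.+1 | P n && (j %| n)%N) F n =
  \sum_(1 <= m < (N %/ j).+1 | P (j * m)%N) F (j * m)%N.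
Proof.
move=> j0; elim: N => [|N IH]; first by rewrite div0n !big_geq.
rewrite big_mkcond big_nat_recr//= -big_mkcond IH divnS//.
have [jN|jN] := boolP (j %| N.+1)%N; last by rewrite andbF addr0.
rewrite andbT add1n [in RHS]big_mkcond [in RHS]big_nat_recr//= -big_mkcond.
suff -> : (j * (N %/ j).+1 = N.+1)%N by [].
by rewrite -[RHS](divnK jN) divnS// jN mulnC.
Qed.

(** The ring is arbitrary because the sieve serves twice: for [n^-1] over the reals and for
    [n^-(s + it)] over the complex numbers. *)
Definition rough_sum (K : nzRingType) (f : nat -> K) (j N : nat) : K :=
  \sum_(1 <= n < N.+1 | rough j n) f n.

Section Sieve.
Variables (K : nzRingType) (f : nat -> K).
Hypothesis fM : forall m n, (0 < m)%N -> (0 < n)%N -> f (m * n)%N = f m * f n.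

(** One sieve step: a [j]-rough number is either prime to [j], hence [j.+1]-rough, or [j] times a
    [j]-rough number up to [N %/ j]. *)
Lemma rough_sumS_prime j N : prime j ->
  rough_sum f j N = rough_sum f j.+1 N + f j * rough_sum f j (N %/ j).
Proof.
move=> jP; have j0 := prime_gt0 jP.
rewrite /rough_sum (bigID (fun n => (j %| n)%N))/= addrC; congr (_ + _).
  rewrite big_nat_cond [RHS]big_nat_cond; apply: eq_bigl => n.
  by case: (posnP n) => [->//|n0]; rewrite roughS// jP.
rewrite big_dvdn// mulr_sumr big_nat_cond [RHS]big_nat_cond.
apply: eq_big => [m|m /andP[/andP[m0 _] _]]; last by rewrite fM.
by case: (posnP m) => [->//|m0]; rewrite roughM.
Qed.

Lemma rough_sumS_nprime j N : ~~ prime j -> rough_sum f j N = rough_sum f j.+1 N.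
Proof.
move=> jP; rewrite /rough_sum big_nat_cond [RHS]big_nat_cond; apply: eq_bigl => n.
by case: (posnP n) => [->//|n0]; rewrite roughS// (negbTE jP) andbT.
Qed.

End Sieve.

(** * Divergence of the sum of the prime reciprocals *)

Section PrimeReciprocals.
Variable R : realType.

(** Sieve the harmonic sum by each prime up to [N]; at the end only the term 1 is left. Each step
    gives an inequality because the sum cut at [N %/ j] is at most the one cut at [N]. *)
Lemma prod_harmonic_le1 N :
  (\prod_(0 <= p < N.+1 | prime p) (1 - p%:R^-1 : R)) * series harmonic N <= 1.
Proof.
pose f n : R := n%:R^-1.
have fM m n : (0 < m)%N -> (0 < n)%N -> f (m * n)%N = f m * f n.
  by move=> _ _; rewrite /f natrM invfM.
have f0 n : 0 <= f n by rewrite invr_ge0.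
have step j : (\prod_(0 <= p < j | prime p) (1 - f p)) * series harmonic N
     <= rough_sum f j N.
  elim: j => [|j IH].
    rewrite big_geq// mul1r /rough_sum /series/= big_add1/=.
    by under [leRHS]eq_bigl do rewrite rough0.
  rewrite big_mkcond big_nat_recr//= -big_mkcond/= mulrAC.
  case: ifPn => jP; last by rewrite mulr1 -(rough_sumS_nprime f).
  have j1 : 0 <= 1 - f j by rewrite subr_ge0 invf_le1 ?ltr0n ?prime_gt0// ler1n prime_gt0.
  apply: le_trans (ler_wpM2r j1 IH) _.
  rewrite mulrBr mulr1 {1}(rough_sumS_prime fM)// -addrA gerDl subr_le0 mulrC ler_wpM2r//.
  rewrite /rough_sum (@big_cat_nat _ _ _ (N %/ j).+1 1 N.+1)//= ?ltnS ?leq_div//.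
  by rewrite lerDl sumr_ge0.
apply: le_trans (step N.+1) _.
rewrite /rough_sum; case: N {step} => [|N]; first by rewrite big_geq ?ler01.
rewrite big_mkcond big_ltn// rough1 big_nat_cond big1 ?addr0 => [|n /andP[/andP[n1 nN] _]].
  by rewrite /= addr0 /f invr1.
by case: ifPn => // /(rough_leq n1); rewrite leqNgt nN.
Qed.

(** Euler's argument: as [(1 - x)^-1 <= expR (2 * x)] for [x] in [0, 1/2], a bound [C] would bound
    all harmonic sums by [expR (2 * C)]. *)
Lemma sum_prime_inv_unbounded (C : R) :
  exists N, C < \sum_(0 <= p < N | prime p) p%:R^-1.
Proof.
apply: contrapT => /forallNP h.
have {}h N : \sum_(0 <= p < N | prime p) p%:R^-1 <= C.
  by rewrite leNgt; apply/negP; exact: h.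
apply: (@dvg_harmonic R); apply: nondecreasing_is_cvgn.
  by apply: nondecreasing_series => n _ _; exact: harmonic_ge0.
exists (expR (2 * C)) => _ [N _ <-].
have P0 : 0 < \prod_(0 <= p < N.+1 | prime p) (1 - p%:R^-1 : R).
  apply: prodr_gt0 => p pP; rewrite subr_gt0 invf_lt1 ?ltr0n ?prime_gt0//.
  by rewrite ltr1n prime_gt1.
have := prod_harmonic_le1 N; rewrite -ler_pdivlMl// mulr1 => /le_trans; apply.
apply: (@le_trans _ _ (expR (2 * \sum_(0 <= p < N.+1 | prime p) p%:R^-1))); last first.
  by rewrite ler_expR ler_pM2l.
rewrite -[leRHS]invrK lef_pV2 ?posrE ?invr_gt0 ?expR_gt0//.
rewrite -expRN mulr_sumr -sumrN expR_sum; apply: ler_prod => p pP.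
rewrite expR_ge0/= expRN -div1r ler_pdivrMr ?expR_gt0//.
have p2 : p%:R^-1 <= 2^-1 :> R by rewrite lef_pV2 ?posrE ?ltr0n ?prime_gt0// ler_nat prime_gt1.
have p0 : 0 <= p%:R^-1 :> R by [].
set x : R := p%:R^-1 in p2 p0 *.
apply: (@le_trans _ _ ((1 - x) * (1 + 2 * x))); first by nra.
by apply: ler_wpM2l; [lra|exact: expR_ge1Dx].
Qed.

End PrimeReciprocals.

(** * Dominated series and powers *)

Section DominatedSeries.
Variable R : realType.
Implicit Types (f b : R^nat).

Lemma dominated_cvg_series f b : (forall k, `|f k| <= b k) ->
  cvgn (series b) -> cvgn (series f).
Proof.
move=> fb cb; apply: normed_cvg.
apply: (series_le_cvg (v_ := b)) => [k|k|k|//].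
- exact: normr_ge0.
- exact: le_trans (normr_ge0 _) (fb k).
- exact: fb.
Qed.

Lemma dominated_series_tail f b N : (forall k, `|f k| <= b k) ->
  cvgn (series b) ->
  `|limn (series f) - series f N| <= limn (series b) - series b N.
Proof.
move=> fb cb; have cf := dominated_cvg_series fb cb.
have b0 k : 0 <= b k by exact: le_trans (normr_ge0 _) (fb k).
apply/ler_addgt0Pr => e e0.
have [M _ hM] := (cvgrPdist_lt _ _).1 cf e e0.
have {}hM := hM (maxn M N) (leq_maxl _ _).
rewrite -(subrKA (series f (maxn M N))) (le_trans (ler_normD _ _))//.
rewrite addrC lerD ?(ltW hM)//.
rewrite sub_series_geq ?leq_maxr// (le_trans (ler_norm_sum _ _ _))//.
apply: (@le_trans _ _ (series b (maxn M N) - series b N)).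
  by rewrite sub_series_geq ?leq_maxr// ler_sum.
rewrite lerD2r; apply: nondecreasing_cvgn_le => //.
by apply: nondecreasing_series => k _ _.
Qed.

Lemma cvg_series_tail b e : cvgn (series b) -> 0 < e ->
  exists N, forall M, (N <= M)%N -> limn (series b) - series b M < e.
Proof.
move=> cb e0; have [N _ hN] := (cvgrPdist_lt _ _).1 cb e e0.
by exists N => M NM; apply: le_lt_trans (hN M NM); exact: ler_norm.
Qed.

(** The Weierstrass test, with the error split into two tails and a finite sum. Domination is asked
    only near [x], since no convergent majorant serves all exponents above 1. *)
Lemma continuous_series (f : nat -> R -> R) b (x : R) :
  (forall k, {for x, continuous (f k)}) ->
  (\forall y \near x, forall k, `|f k y| <= b k) -> cvgn (series b) ->
  {for x, continuous (fun y => limn (series (f ^~ y)))}.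
Proof.
move=> fc fb cb; apply/cvgrPdist_lt => e e0.
have e3 : 0 < e / 3 by rewrite divr_gt0.
have [N hN] := cvg_series_tail cb e3.
have {}hN := hN N (leqnn N).
have cN : series (f ^~ y) N @[y --> x] --> series (f ^~ x) N.
  elim: N {hN} => [|N IH].
    by rewrite [X in X @ _](_ : _ = cst 0) ?/series/= ?big_geq//;
      [exact: cvg_cst|apply/funext => y; rewrite /series/= big_geq].
  rewrite seriesSr [X in X @ _](_ : _ = fun y => series (f ^~ y) N + f N y).
    by apply: cvgD => //; exact: fc.
  by apply/funext => y; rewrite seriesSr.
have bx := nbhs_singleton fb.
near=> y.
have by_ : forall k, `|f k y| <= b k by near: y.
have h1 := le_lt_trans (dominated_series_tail N bx cb) hN.
have h2 := le_lt_trans (dominated_series_tail N by_ cb) hN.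
have h3 : `|series (f ^~ x) N - series (f ^~ y) N| < e / 3.
  by near: y; exact: (cvgrPdist_lt _ _).1 cN _ e3.
move: h1 h2 h3; rewrite !ltr_norml => /andP[? ?] /andP[? ?] /andP[? ?].
apply/andP; split; lra.
Unshelve. all: by end_near. Qed.

End DominatedSeries.

(* [npow s k] is [k^-s] for [k > 0]; since [ln 0 = 0], [npow s 0 = 1]. *)
Definition npow (R : realType) (s : R) (k : nat) : R := expR (- s * ln k%:R).

Section Npow.
Variable R : realType.
Implicit Types (s : R) (k : nat).

Lemma npow_gt0 s k : 0 < npow s k. Proof. exact: expR_gt0. Qed.

Lemma npow_1r s : npow s 1 = 1.
Proof. by rewrite /npow ln1 mulr0 expR0. Qed.

Lemma ln_nat_ge0 k : 0 <= ln k%:R :> R.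
Proof.
by case: k => [|k]; [rewrite ln0|rewrite ln_ge0// ler1n].
Qed.

Lemma npow_le s s' k : s' <= s -> npow s k <= npow s' k.
Proof. by move=> ss; rewrite ler_expR ler_wpM2r ?ln_nat_ge0// lerN2. Qed.

Lemma npow1 k : (0 < k)%N -> npow 1 k = k%:R^-1 :> R.
Proof. by move=> k0; rewrite /npow mulN1r expRN lnK// posrE ltr0n. Qed.

Lemma npowX2 s k : npow s k ^+ 2 = npow (s *+ 2) k.
Proof.
by rewrite expr2 -expRD; congr expR; rewrite -mulrDl mulr2n opprD.
Qed.

Lemma npow_lt1 s k : 0 < s -> (1 < k)%N -> npow s k < 1.
Proof. by move=> s0 k1; rewrite expR_lt1 mulNr oppr_lt0 mulr_gt0// ln_gt0// ltr1n. Qed.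

Lemma npow_le_half s k : 1 <= s -> (1 < k)%N -> npow s k <= 2^-1.
Proof.
move=> s1 k1; rewrite (le_trans (npow_le k s1))// npow1 ?(ltnW k1)//.
by rewrite lef_pV2 ?posrE ?ltr0n ?(ltnW k1)// ler_nat.
Qed.

(** A discrete form of the integral test, from [expR y >= 1 + y] and [ln (k.+1 / k) >= k.+1^-1]. *)
Lemma npow_telescope s k : 1 < s -> (0 < k)%N ->
  npow s k.+1 <= (s - 1)^-1 * (npow (s - 1) k - npow (s - 1) k.+1).
Proof.
move=> s1 k0; have d0 : 0 < s - 1 by rewrite subr_gt0.
rewrite mulrC ler_pdivlMr//.
have -> : npow s k.+1 = npow (s - 1) k.+1 * k.+1%:R^-1.
  rewrite -[s in LHS](subrK 1) -npow1// -expRD; congr expR.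
  by rewrite opprD mulrDl.
have -> : npow (s - 1) k = npow (s - 1) k.+1 * expR ((s - 1) * (ln k.+1%:R - ln k%:R)).
  rewrite -expRD; congr expR; ring.
have h : k.+1%:R^-1 <= ln k.+1%:R - ln k%:R :> R.
  rewrite -lerN2 opprB -ln_div ?posrE ?ltr0n//.
  have -> : k%:R / k.+1%:R = 1 + - k.+1%:R^-1 :> R.
    by rewrite -[k%:R](addrK 1) natr1 mulrBl divff// mul1r.
  by apply: le_ln1Dx; rewrite ltrN2 invf_lt1 ?ltr0n// ltr1n.
have := expR_ge1Dx ((s - 1) * (ln k.+1%:R - ln k%:R)).
set E := expR _ => hE.
have P0 := npow_gt0 (s - 1) k.+1.
rewrite -mulrA -[X in _ <= _ - X]mulr1 -mulrBr ler_wpM2l ?(ltW P0)//.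
rewrite mulrC lerBrDr (le_trans _ hE)// addrC lerD2l ler_wpM2l// ltW//.
Qed.

Lemma cvg_series_npow s : 1 < s -> cvgn (series (fun k => npow s k.+1)).
Proof.
move=> s1; apply: nondecreasing_is_cvgn.
  by apply: nondecreasing_series => k _ _; exact: ltW (npow_gt0 _ _).
have d0 : 0 < (s - 1)^-1 by rewrite invr_gt0 subr_gt0.
exists (1 + (s - 1)^-1) => _ [N _ <-].
suff h M : series (fun k => npow s k.+1) M.+1 <= 1 + (s - 1)^-1 * (1 - npow (s - 1) M.+1).
  case: N => [|N]; first by rewrite /series/= big_geq// addr_ge0// ltW.
  apply: le_trans (h N) _; rewrite lerD2l ler_piMr ?(ltW d0)// gerBl.
  exact: ltW (npow_gt0 _ _).
elim: M => [|M IH].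
  by rewrite /series/= big_nat1 !npow_1r subrr mulr0 addr0.
rewrite seriesSr; apply: le_trans (lerD IH (npow_telescope s1 (ltn0Sn M))) _.
by rewrite -addrA -mulrDr addrA subrK.
Qed.

Lemma continuous_npow k : continuous (fun s => npow s k).
Proof.
move=> s; apply: continuous_comp; last exact: continuous_expR.
by apply: cvgM; [apply: cvgN; exact: cvg_id|exact: cvg_cst].
Qed.

End Npow.

(** * The Euler product *)

Lemma cvg_ext (T : Type) (U : topologicalType) (F : set_system T) (f g : T -> U)
  (l : U) : f =1 g -> f @ F --> l -> g @ F --> l.
Proof. by move=> /funext ->. Qed.

(** * Complex limits through real and imaginary parts, and the complex exponential *)

Section ComplexLimits.
Variable R : realType.
Implicit Types (a b : R).

Lemma norm_complex_le a b : `|a +i* b : R[i]| <= (`|a| + `|b|)%:C.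
Proof.
rewrite normc_def lecR/= -(ler_pXn2r (ltn0Sn 1)) ?nnegrE ?sqrtr_ge0 ?addr_ge0//.
rewrite sqr_sqrtr ?addr_ge0 ?sqr_ge0// sqrrD !real_normK ?num_real//.
by rewrite addrAC lerDl mulrn_wge0// mulr_ge0.
Qed.

Lemma cvg_complex (T : Type) (F : set_system T) (FF : Filter F) (u v : T -> R) a b :
  u @ F --> a -> v @ F --> b -> (fun x => u x +i* v x : R[i]^o) @ F --> (a +i* b : R[i]^o).
Proof.
move=> /cvgrPdist_lt ua /cvgrPdist_lt vb; apply/cvgrPdist_lt => -[e e'].
(* In the order of [R[i]], a positive radius has zero imaginary part, so it is a positive real. *)
rewrite ltcE/= => /andP[/eqP -> e0].
have e2 : 0 < e / 2 by rewrite divr_gt0.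
near=> x.
apply: (@le_lt_trans _ _ (`|a - u x| + `|b - v x|)%:C).
  exact: norm_complex_le.
rewrite ltcR [e]splitr ltrD//; near: x; [exact: ua|exact: vb].
Unshelve. all: by end_near. Qed.

Lemma cvg_norm_complex (T : Type) (F : set_system T) (FF : Filter F)
    (u : T -> R[i]^o) (l : R[i]^o) :
  u @ F --> l -> (fun x => `|u x| : R[i]^o) @ F --> (`|l| : R[i]^o).
Proof.
move=> /cvgrPdist_lt ul; apply/cvgrPdist_lt => e e0.
have := ul e e0; apply: filterS => x; apply: le_lt_trans; exact: ler_dist_dist.
Qed.

Lemma series_complex (u v : R^nat) n :
  series (fun k => u k +i* v k : R[i]^o) n = series u n +i* series v n.
Proof.
elim: n => [|n IH]; first by rewrite /series/= !big_geq.
by rewrite !seriesSr IH.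
Qed.

Lemma cexpD (z w : R[i]) : cexp (z + w) = cexp z * cexp w.
Proof.
case: z w => [a b] [c d]; rewrite /cexp/= expRD cosD sinD.
apply/eqP; rewrite eq_complex/=; apply/andP; split; apply/eqP; ring.
Qed.

Lemma cexp_imD (x y : R) : cexp (0 +i* (x + y)) = cexp (0 +i* x) * cexp (0 +i* y).
Proof. by rewrite -cexpD; congr cexp; rewrite /GRing.add/= addr0. Qed.

Lemma cexp_im0 : cexp (0 +i* 0) = 1 :> R[i].
Proof. by rewrite /cexp/= expR0 cos0 sin0 mulr1 mulr0. Qed.

Lemma norm_cexp_im (x : R) : `|cexp (0 +i* x)| = 1.
Proof. by rewrite normc_def/= expR0 !mul1r cos2Dsin2 sqrtr1. Qed.

Lemma cvg_cexp_im (T : Type) (F : set_system T) (FF : Filter F) (u : T -> R) (a : R) :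
  u @ F --> a -> (fun x => cexp (0 +i* u x) : R[i]^o) @ F --> (cexp (0 +i* a) : R[i]^o).
Proof.
move=> ua; apply: cvg_complex => /=; rewrite expR0 mul1r;
  under eq_fun do rewrite mul1r.
  exact: (cvg_comp _ _ ua (@continuous_cos R a)).
exact: (cvg_comp _ _ ua (@continuous_sin R a)).
Qed.

End ComplexLimits.

(* [dpow s t k] is [k^-(s + it)]. *)
Definition dpow (R : realType) (s t : R) (k : nat) : R[i] :=
  cexp (- (s +i* t) * (ln k%:R)%:C).

Section Dpow.
Variable R : realType.
Implicit Types (s t : R) (k : nat).

Lemma dpowE s t k :
  dpow s t k = npow s k * cos (t * ln k%:R) +i* - (npow s k * sin (t * ln k%:R)).
Proof.
rewrite /dpow /cexp/= !mulr0 subr0 add0r [- t * _]mulNr cosN sinN mulrN.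
by rewrite /npow.
Qed.

Lemma dpowM s t m n : (0 < m)%N -> (0 < n)%N -> dpow s t (m * n)%N = dpow s t m * dpow s t n.
Proof.
move=> m0 n0; rewrite /dpow -cexpD -mulrDr -rmorphD/=; congr cexp; congr (_ * _%:C).
by rewrite natrM lnM// posrE ltr0n.
Qed.

End Dpow.

(* Limit, along [j], of the sums over [j]-rough numbers: only the term [n = 1]
   survives. *)
Section RoughSeries.
Variables (R : realType) (g b : R^nat).
Hypotheses (gb : forall k, `|g k| <= b k) (cb : cvgn (series b)).

Definition rough_restr (j k : nat) : R := if rough j k.+1 then g k else 0.

Lemma rough_restr_le j k : `|rough_restr j k| <= b k.
Proof.
rewrite /rough_restr; case: ifP => // _; rewrite normr0.
exact: le_trans (normr_ge0 _) (gb k).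
Qed.

Lemma cvg_rough_restr j : cvgn (series (rough_restr j)).
Proof. exact: dominated_cvg_series (rough_restr_le j) cb. Qed.

Lemma lim_rough_restr : limn (series (rough_restr j)) @[j --> \oo] --> g 0%N.
Proof.
(* Index [k] stands for the number [k.+1]. At level [j.+2], the first [j.+1] terms concern numbers
   below the level, so only that of 1 is nonzero and the partial sum is exactly [g 0]. *)
rewrite -(cvg_shiftn 2); apply/cvgrPdist_lt => e e0.
have [N hN] := cvg_series_tail cb e0.
exists N => // j /= Nj; rewrite distrC addn2.
have -> : g 0%N = series (rough_restr j.+2) j.+1.
  rewrite /series/= big_ltn//= big_nat_cond big1 ?addr0 => [|k]; last first.
    rewrite /rough_restr => /andP[/andP[k0 kj] _]; case: ifP => //.
    by move/(rough_leq (k0 : 1 < k.+1)%N); rewrite ltnNge kj.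
  by rewrite /rough_restr rough1.
apply: le_lt_trans (dominated_series_tail _ (rough_restr_le _) cb) _.
exact/hN/leqW.
Qed.

End RoughSeries.

Section Zeta.
Variables (R : realType) (s t : R).
Hypothesis s1 : 1 < s.

(** Real and, next, imaginary part of [dpow s t k.+1]; complex convergence is thereby reduced to
    dominated real series. *)
Definition dre (k : nat) : R := npow s k.+1 * cos (t * ln k.+1%:R).
Definition dim (k : nat) : R := - (npow s k.+1 * sin (t * ln k.+1%:R)).

Lemma dre_le k : `|dre k| <= npow s k.+1.
Proof.
rewrite normrM gtr0_norm ?npow_gt0// ler_piMr ?(ltW (npow_gt0 _ _))//.
by rewrite ler_norml cos_geN1 cos_le1.
Qed.

Lemma dim_le k : `|dim k| <= npow s k.+1.
Proof.
rewrite normrN normrM gtr0_norm ?npow_gt0// ler_piMr ?(ltW (npow_gt0 _ _))//.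
by rewrite ler_norml sin_geN1 sin_le1.
Qed.

Lemma zetaE : zeta (s +i* t) = limn (series dre) +i* limn (series dim).
Proof.
rewrite /zeta; apply: cvg_lim => //.
have -> : (fun k => cexp (- (s +i* t) * (ln k.+1%:R)%:C) : R[i]^o) =
    (fun k => dre k +i* dim k).
  by apply/funext => k; exact: dpowE.
have -> : series (fun k => dre k +i* dim k : R[i]^o) =
    (fun n => series dre n +i* series dim n).
  by apply/funext => n; exact: series_complex.
have c := cvg_series_npow s1.
apply: cvg_complex.
  exact: dominated_cvg_series dre_le c.
exact: dominated_cvg_series dim_le c.
Qed.

Definition rough_zeta (j : nat) : R[i]^o :=
  limn (series (rough_restr dre j)) +i* limn (series (rough_restr dim j)).

Lemma cvg_rough_sum j : (rough_sum (dpow s t) j : nat -> R[i]^o) @ \oo --> rough_zeta j.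
Proof.
have -> : (rough_sum (dpow s t) j : nat -> R[i]^o) =
    (fun n => series (rough_restr dre j) n +i* series (rough_restr dim j) n).
  apply/funext => n; rewrite -series_complex /rough_sum /series/= big_add1/= big_mkcond.
  apply: eq_bigr => k _; rewrite /rough_restr; case: ifP => // _; exact: dpowE.
have c := cvg_series_npow s1.
apply: cvg_complex.
  exact: (cvg_rough_restr dre_le c).
exact: (cvg_rough_restr dim_le c).
Qed.

Lemma cvg_rough_zeta : rough_zeta @ \oo --> (1 : R[i]^o).
Proof.
have c := cvg_series_npow s1.
have -> : (1 : R[i]^o) = dre 0 +i* dim 0.
  by rewrite /dre /dim npow_1r ln1 mulr0 cos0 sin0 !mul1r oppr0.
apply: cvg_complex.
  exact: lim_rough_restr dre_le c.
exact: lim_rough_restr dim_le c.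
Qed.

Lemma rough_zeta0 : rough_zeta 0 = zeta (s +i* t).
Proof.
by rewrite zetaE /rough_zeta; congr (limn _ +i* limn _); congr series;
  apply/funext => k; rewrite /rough_restr rough0.
Qed.

Lemma cvg_divn (p : nat) : (0 < p)%N -> (fun n => n %/ p)%N @ \oo --> \oo.
Proof.
move=> p0 A [N _ NA]; exists (N * p)%N => // n /= Nn.
by apply: NA; rewrite /= leq_divRL.
Qed.

Lemma rough_zetaS j :
  rough_zeta j.+1 = (if prime j then 1 - dpow s t j else 1) * rough_zeta j.
Proof.
have cj := cvg_rough_sum (j := j).
have cS := cvg_rough_sum (j := j.+1).
case: ifPn => jP; last first.
  rewrite mul1r; apply: (cvg_unique _ cS); first by [].
  by apply: cvg_ext cj => n; rewrite (rough_sumS_nprime _ _ jP).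
(* The cut-off [n %/ j] also tends to infinity, so both sums in the sieve step have the same
   limit. *)
have cd := cvg_comp _ _ (cvg_divn (prime_gt0 jP)) cj.
have cD : (fun n => rough_sum (dpow s t) j n - dpow s t j * rough_sum (dpow s t) j (n %/ j)
    : R[i]^o) @ \oo --> (rough_zeta j - dpow s t j * rough_zeta j : R[i]^o).
  by apply: cvgB cj _; apply: cvgM cd; exact: cvg_cst.
rewrite mulrBl mul1r.
apply: (cvg_unique _ cS); first by [].
apply: cvg_ext cD => n /=.
by rewrite (rough_sumS_prime (@dpowM _ s t) _ jP) addrK.
Qed.

(** The product over [p < j] times zeta is exactly the sum over [j]-rough numbers. Without inverses,
    the limit 1 also yields that zeta does not vanish. *)
Lemma cvg_euler_prod :
  (fun j => (\prod_(0 <= p < j | prime p) (1 - dpow s t p)) * zeta (s +i* t) : R[i]^o)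
    @ \oo --> (1 : R[i]^o).
Proof.
apply: cvg_ext cvg_rough_zeta => j; rewrite -rough_zeta0.
elim: j => [|j IH]; first by rewrite big_geq// mul1r.
rewrite big_mkcond big_nat_recr//= -big_mkcond rough_zetaS IH.
by case: ifP => _; rewrite mulrCA mulrA// mulrC.
Qed.

End Zeta.

(** * The argument of zeta *)

(* [phase r x] is the argument of [(1 - r e^(- i x))^-1]. *)
Definition phase (R : realType) (r x : R) : R :=
  - atan (r * sin x / (1 - r * cos x)).

Section Phase.
Variable R : realType.
Implicit Types (r x y : R).

Lemma oneBcos_gt0 r x : 0 <= r -> r < 1 -> 0 < 1 - r * cos x.
Proof.
move=> r0 r1; rewrite subr_gt0 (le_lt_trans _ r1)// ler_piMr// cos_le1//.
Qed.

(** For [r < 1] the point lies in the right half-plane, where the arctangent of the slope is an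
    argument. *)
Lemma phase_polar r x : 0 <= r -> r < 1 -> exists2 M, 0 < M &
  (1 - r * cos x) +i* (r * sin x) = M%:C * cexp (0 +i* - phase r x).
Proof.
move=> r0 r1; have u0 := oneBcos_gt0 x r0 r1.
rewrite /phase opprK; set u := 1 - _ in u0 *; set v := r * _.
have c0 : 0 < cos (atan (v / u)).
  by apply: cos_gt0_pihalf; rewrite atan_gtNpi2 atan_ltpi2.
exists (u / cos (atan (v / u))); first by rewrite divr_gt0.
rewrite /cexp/= expR0 !mul1r.
apply/eqP; rewrite eq_complex/= !mul0r subr0 addr0; apply/andP; split; apply/eqP.
  by rewrite divfK// gt_eqF.
have := atanK (v / u); rewrite /tan => e.
by rewrite mulrAC -mulrA e mulrC divfK// gt_eqF.
Qed.

Lemma atan_mvt y : exists2 z, `|z| <= `|y| & atan y = y / (1 + z ^+ 2).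
Proof.
wlog y0 : y / 0 <= y => [h|].
  have [/h//|/ltW y0] := leP 0 y.
  have [|z zy e] := h (- y); first by rewrite oppr_ge0.
  exists z; first by rewrite -[`|y|]normrN.
  by apply: oppr_inj; rewrite -atanN e mulNr.
have [z] := @MVT_segment R (@atan R) _ 0 y y0 (fun x _ => is_derive1_atan x)
  (continuous_subspaceT (@continuous_atan R)).
rewrite in_itv/= => /andP[z0 zy]; rewrite atan0 !subr0 => e; exists z.
  by rewrite !ger0_norm.
by rewrite e mulrC.
Qed.

Lemma atan_le y : `|atan y| <= `|y|.
Proof.
have [z _ ->] := atan_mvt y.
have z0 : 0 < 1 + z ^+ 2 by rewrite ltr_pwDl// sqr_ge0.
rewrite normrM ler_piMr// gtr0_norm ?invr_gt0// invf_le1//.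
by rewrite lerDl sqr_ge0.
Qed.

Lemma atan_sub_le y : `|atan y - y| <= y ^+ 2.
Proof.
have [z zy ->] := atan_mvt y.
have z2 := sqr_ge0 z.
have z0 : 0 < 1 + z ^+ 2 by rewrite ltr_pwDl.
have -> : y / (1 + z ^+ 2) - y = - (y * (z ^+ 2 / (1 + z ^+ 2))).
  by field; rewrite gt_eqF.
rewrite normrN normrM -[y ^+ 2]real_normK ?num_real// [`|y| ^+ 2]expr2 ler_wpM2l//.
rewrite ger0_norm ?divr_ge0 ?(ltW z0)// (le_trans _ zy)// ler_pdivrMr//.
rewrite -[z ^+ 2]real_normK ?num_real//.
have := normr_ge0 z; set w := `|z|; nra.
Qed.

Lemma phase_arg_le r x : 0 <= r -> r <= 2^-1 ->
  `|r * sin x / (1 - r * cos x)| <= 2 * r.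
Proof.
move=> r0 r1; have r2 : r < 1 by lra.
have u0 := oneBcos_gt0 x r0 r2.
rewrite normrM normfV (gtr0_norm u0) ler_pdivrMr// normrM ger0_norm//.
rewrite mulrAC [leRHS]mulrC ler_wpM2l//.
have s1 : `|sin x| <= 1 by rewrite ler_norml sin_geN1 sin_le1.
have := cos_le1 x; set c := cos x in u0 *; move: s1; set w := `|_|; nra.
Qed.

Lemma phase_le r x : 0 <= r -> r <= 2^-1 -> `|phase r x| <= 2 * r.
Proof.
move=> r0 r1; rewrite /phase normrN; apply: le_trans (atan_le _) _.
exact: phase_arg_le.
Qed.

(** Replacing [atan y] by [y], where [y] is at most [2 * r] in size, costs [4 * r ^+ 2]; dropping
    the denominator costs [2 * r ^+ 2]. *)
Lemma phase_sin_le r x : 0 <= r -> r <= 2^-1 ->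
  `|phase r x + r * sin x| <= 6 * r ^+ 2.
Proof.
move=> r0 r1; have r2 : r < 1 by lra.
have u0 := oneBcos_gt0 x r0 r2.
have h := phase_arg_le x r0 r1; have h2 := atan_sub_le (r * sin x / (1 - r * cos x)).
have e : r * sin x / (1 - r * cos x) - r * sin x =
    (r * sin x / (1 - r * cos x)) * (r * cos x) by field; rewrite gt_eqF.
rewrite /phase -normrN; set y := r * sin x / _ in h h2 e *.
have -> : - (- atan y + r * sin x) = (atan y - y) + y * (r * cos x).
  by rewrite -e; ring.
apply: le_trans (ler_normD _ _) _.
have -> : 6 * r ^+ 2 = (2 * r) ^+ 2 + 2 * r * r by ring.
apply: lerD.
  by apply: le_trans h2 _; rewrite -[y ^+ 2]real_normK ?num_real// lerXn2r ?nnegrE// mulr_ge0.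
rewrite normrM ler_pM// normrM ger0_norm// ler_piMr//.
by rewrite ler_norml cos_geN1 cos_le1.
Qed.

Lemma continuous_phase x (r : R) : 0 <= r -> r < 1 ->
  {for r, continuous (fun r => phase r x)}.
Proof.
move=> r0 r1; apply: cvgN.
apply: (@continuous_comp _ _ _ (fun r => r * sin x / (1 - r * cos x)) (@atan R));
  last exact: continuous_atan.
have u0 := oneBcos_gt0 x r0 r1.
apply: cvgM; first by apply: cvgM; [exact: cvg_id|exact: cvg_cst].
apply: cvgV; first by rewrite gt_eqF.
apply: cvgB; first exact: cvg_cst.
by apply: cvgM; [exact: cvg_id|exact: cvg_cst].
Qed.

End Phase.

Definition prime_phase (R : realType) (t s : R) (k : nat) : R :=
  if prime k then phase (npow s k) (t * ln k%:R) else 0.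

(** Phases are added as real numbers, without reduction modulo [2 * pi]; this keeps the argument
    continuous in [s]. *)
Definition zeta_arg (R : realType) (t s : R) : R := limn (series (prime_phase t s)).

(** Taking moduli, [M j * |z|] tends to 1, so [z] is nonzero. Then [M j * |z| * z] tends both to [z]
    and to [|z| * e]. *)
Lemma polar_of_cvg (R : realType) (M : nat -> R) (z e : R[i]^o) :
  (forall j, 0 < M j) -> `|e| = 1 ->
  (fun j => (M j)%:C * z : R[i]^o) @ \oo --> e -> z != 0 /\ z = `|z| * e.
Proof.
move=> M0 e1 c1.
have c2 : (fun j => (M j)%:C * `|z| : R[i]^o) @ \oo --> (1 : R[i]^o).
  have : (fun j => `|(M j)%:C * z| : R[i]^o) @ \oo --> (`|e| : R[i]^o).
    exact: (cvg_norm_complex _ c1).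
  rewrite e1; apply: cvg_ext => j.
  by rewrite normrM; congr (_ * _); rewrite ger0_norm// ler0c ltW.
split.
  apply/eqP => z0.
  have c0 : (fun j => (M j)%:C * `|z| : R[i]^o) @ \oo --> (0 : R[i]^o).
    by rewrite z0 normr0; apply: (cvg_ext (f := cst 0)) (cvg_cst _) => j; rewrite mulr0.
  have : (0 : R[i]^o) = 1 by apply: (cvg_unique _ c0 c2); exact: norm_hausdorff.
  by move/eqP; rewrite eq_sym oner_eq0.
have c3 : (fun j => z * ((M j)%:C * `|z|) : R[i]^o) @ \oo --> (z * 1 : R[i]^o).
  by apply: cvgM c2; exact: cvg_cst.
have c4 : (fun j => `|z| * ((M j)%:C * z) : R[i]^o) @ \oo --> (`|z| * e : R[i]^o).
  by apply: cvgM c1; exact: cvg_cst.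
rewrite mulr1 in c3.
apply: (cvg_unique _ c3); first exact: norm_hausdorff.
apply: cvg_ext c4 => j.
by rewrite mulrCA [RHS]mulrCA [z * _]mulrC.
Qed.

Lemma near_gt (R : realType) (a x : R) : a < x -> \forall y \near x, a < y.
Proof.
move=> ax; have /near_in_itvoy : x \in `]a, +oo[ by rewrite in_itv/= ax.
by apply: filterS => y; rewrite in_itv/= andbT.
Qed.

Lemma near_ge (R : realType) (a x : R) : a < x -> \forall y \near x, a <= y.
Proof. by move=> /near_gt; apply: filterS => y /ltW. Qed.

(** * Continuity and polar form of zeta in [s] for fixed [t] *)

Section ZetaArg.
Variables (R : realType) (t : R).
Implicit Type s : R.

Lemma cvg_series_npow0 s : 1 < s -> cvgn (series (npow s)).
Proof.
move=> /cvg_series_npow/cvg_ex[l hl]; apply/cvg_ex; exists (npow s 0 + l).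
rewrite -cvg_shiftS; 
have : (fun n => npow s 0 + series (fun k => npow s k.+1) n) @ \oo --> npow s 0 + l.
  by apply: cvgD hl; exact: cvg_cst.
apply: cvg_ext => n.
by rewrite /series/= big_nat_recl.
Qed.

Lemma prime_phase_le s k : 1 <= s -> `|prime_phase t s k| <= 2 * npow s k.
Proof.
move=> s1; have n0 := ltW (npow_gt0 s k); rewrite /prime_phase.
case: ifPn => [kP|_]; last by rewrite normr0 mulr_ge0.
by rewrite phase_le// npow_le_half// prime_gt1.
Qed.

Lemma cvg_series_2npow s : 1 < s -> cvgn (series (fun k => 2 * npow s k)).
Proof.
move=> s1; rewrite (_ : (fun k => _) = 2 *: npow s)//.
by apply: is_cvg_seriesZ; exact: cvg_series_npow0.
Qed.

Lemma cvg_prime_phase s : 1 < s -> cvgn (series (prime_phase t s)).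
Proof.
move=> s1; apply: dominated_cvg_series (cvg_series_2npow s1) => k.
exact: prime_phase_le (ltW s1).
Qed.

Lemma continuous_zeta_arg s : 1 < s -> {for s, continuous (zeta_arg t)}.
Proof.
(* The midpoint of 1 and [s] is an exponent that still gives a convergent majorant and lies below
   all exponents near [s]. *)
move=> s1; have m1 : 1 < (1 + s) / 2 by lra.
have ms : (1 + s) / 2 < s by lra.
apply: (@continuous_series R (fun k y => prime_phase t y k)
  _ s _ _ (cvg_series_2npow m1)) => [k|].
  rewrite /prime_phase; case: (boolP (prime k)) => kP; last exact: cvg_cst.
  have n0 := npow_gt0 s k.
  have n1 : npow s k < 1 by apply: npow_lt1 (prime_gt1 kP); lra.
  apply: (@continuous_comp _ _ _ (fun s => npow s k)
    (fun r => phase r (t * ln k%:R))); first exact: continuous_npow.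
  exact: continuous_phase (ltW n0) n1.
near=> y => k.
have my : (1 + s) / 2 <= y by near: y; exact: near_ge.
apply: le_trans (prime_phase_le _ _) _; first exact: le_trans (ltW m1) my.
by rewrite ler_pM2l// npow_le.
Unshelve. all: by end_near. Qed.

Lemma continuous_zeta s : 1 < s -> {for s, continuous (fun s => zeta (s +i* t))}.
Proof.
move=> s1; have m1 : 1 < (1 + s) / 2 by lra.
have ms : (1 + s) / 2 < s by lra.
have h (g : R -> nat -> R) : (forall y k, `|g y k| <= npow y k.+1) ->
    (forall k, continuous (g ^~ k)) -> {for s, continuous (fun y => limn (series (g y)))}.
  move=> gle gc; apply: (@continuous_series R (fun k y => g y k)
    _ s _ _ (cvg_series_npow m1)) => [k|]; first exact: gc.
  near=> y => k.
  have my : (1 + s) / 2 <= y by near: y; exact: near_ge.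
  exact: le_trans (gle y k) (npow_le _ my).
have hr : {for s, continuous (fun y => limn (series (dre y t)))}.
  apply: h => [y k|k y]; first exact: dre_le.
  by apply: cvgM; [exact: continuous_npow|exact: cvg_cst].
have hi : {for s, continuous (fun y => limn (series (dim y t)))}.
  apply: h => [y k|k y]; first exact: dim_le.
  by apply: cvgN; apply: cvgM; [exact: continuous_npow|exact: cvg_cst].
rewrite /prop_for/continuous_at zetaE//.
(* [zetaE] needs an exponent above 1, so the two functions are only compared near [s]. *)
apply: cvg_trans (cvg_complex _ hr hi); apply: near_eq_cvg.
near=> y; rewrite zetaE//; near: y; exact: near_gt.
Unshelve. all: by end_near. Qed.

Lemma euler_prod_polar s j : 1 < s -> exists2 M, 0 < M &
  \prod_(0 <= p < j | prime p) (1 - dpow s t p) =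
  M%:C * cexp (0 +i* - series (prime_phase t s) j).
Proof.
move=> s1; elim: j => [|j [M M0 IH]].
  by exists 1 => //; rewrite /series/= !big_geq// oppr0 cexp_im0 mulr1.
rewrite big_mkcond big_nat_recr//= -big_mkcond IH seriesSr /prime_phase.
case: ifPn => jP; last by exists M => //; rewrite addr0 mulr1.
have n0 := npow_gt0 s j.
have n1 : npow s j < 1 by apply: npow_lt1 (prime_gt1 jP); lra.
have [M' M'0 e] := phase_polar (t * ln j%:R) (ltW n0) n1.
exists (M * M'); first by rewrite mulr_gt0.
have -> : 1 - dpow s t j = M'%:C * cexp (0 +i* - phase (npow s j) (t * ln j%:R)).
  by rewrite -e dpowE; apply/eqP; rewrite eq_complex/= opprK add0r !eqxx.
by rewrite opprD cexp_imD rmorphM/= mulrACA.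
Qed.

Lemma zeta_polar s : 1 < s -> zeta (s +i* t) != 0 /\
  zeta (s +i* t) = `|zeta (s +i* t)| * cexp (0 +i* zeta_arg t s).
Proof.
move=> s1; set z := zeta _.
have [M M0 ME] : exists2 M : nat -> R, (forall j, 0 < M j) & forall j,
    \prod_(0 <= p < j | prime p) (1 - dpow s t p) =
    (M j)%:C * cexp (0 +i* - series (prime_phase t s) j).
  have /choice[M h] : forall j, exists M, 0 < M /\
    \prod_(0 <= p < j | prime p) (1 - dpow s t p) =
    M%:C * cexp (0 +i* - series (prime_phase t s) j).
    by move=> j; have [M] := euler_prod_polar j s1; exists M.
  by exists M => j; have [] := h j.
have c1 : (fun j => (M j)%:C * z : R[i]^o) @ \oo --> (cexp (0 +i* zeta_arg t s) : R[i]^o).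
  (* Rotating the partial Euler product by its phases leaves positive multiples of [z], which then
     converge to the point of argument [zeta_arg t s] on the unit circle. *)
  have : (fun j => cexp (0 +i* series (prime_phase t s) j) *
      ((\prod_(0 <= p < j | prime p) (1 - dpow s t p)) * z) : R[i]^o) @ \oo -->
      (cexp (0 +i* zeta_arg t s) * 1 : R[i]^o).
    apply: cvgM; last exact: cvg_euler_prod.
    by apply: cvg_cexp_im; exact: cvg_prime_phase.
  rewrite mulr1; apply: cvg_ext => j.
  by rewrite ME -/z mulrA mulrCA -cexp_imD subrr cexp_im0 mulr1.
exact: (polar_of_cvg M0 (norm_cexp_im _) c1).
Qed.

End ZetaArg.

(** * Large variation of the argument *)

Section Turns.
Variable R : realType.
Implicit Types (s t : R).

Let dominant t s N : R :=
  - \sum_(0 <= p < N | prime p) npow s p * sin (t * ln p%:R).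

Lemma sum_npow_le s N : 1 < s -> series (npow s) N <= limn (series (npow s)).
Proof.
move=> s1; apply: nondecreasing_cvgn_le; last exact: cvg_series_npow0.
by apply: nondecreasing_series => k _ _; exact: ltW (npow_gt0 _ _).
Qed.

Lemma sum_prime_npow_le s N : 1 < s ->
  \sum_(0 <= p < N | prime p) npow s p <= limn (series (npow s)).
Proof.
move=> s1; apply: le_trans (sum_npow_le N s1).
rewrite big_mkcond; apply: ler_sum => k _; case: ifP => // _.
exact: ltW (npow_gt0 _ _).
Qed.

(* The quadratic error terms contribute a constant independent of [s] and [t]. *)
Lemma zeta_arg_approx s : 1 < s -> exists N0, forall N t, (N0 <= N)%N ->
  `|zeta_arg t s - dominant t s N| < 6 * limn (series (npow (2 : R))) + 1.
Proof.
(* The majorant does not involve [t], so neither does [N0]; the tail accounts for the summand 1 in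
   the bound. *)
move=> s1; have [N0 hN0] := cvg_series_tail (cvg_series_2npow s1) ltr01.
exists N0 => N t NN.
rewrite -(subrKA (series (prime_phase t s) N)) (le_lt_trans (ler_normD _ _))//.
rewrite addrC ler_ltD//; last first.
  apply: le_lt_trans (hN0 N NN).
  apply: dominated_series_tail (cvg_series_2npow s1) => k.
  exact: prime_phase_le (ltW s1).
rewrite opprK /series/= [X in _ + X]big_mkcond -big_split/=.
apply: le_trans (ler_norm_sum _ _ _) _.
have s2 : 1 < 2 :> R by rewrite ltr1n.
apply: (@le_trans _ _ (6 * series (npow 2) N)); last by rewrite ler_pM2l// sum_npow_le.
rewrite /series/= mulr_sumr; apply: ler_sum => k _; rewrite /prime_phase.
case: ifPn => kP; last by rewrite addr0 normr0 mulr_ge0// ltW// npow_gt0.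
apply: le_trans (phase_sin_le _ (ltW (npow_gt0 _ _)) (npow_le_half (ltW s1) (prime_gt1 kP))) _.
(* Squares have exponent [s *+ 2 >= 2], so the series at exponent 2 bounds them for every [s]. *)
by rewrite ler_pM2l// npowX2 npow_le// mulr2n; lra.
Qed.

(** A finite sum of prime reciprocals exceeds [C], and by continuity it still does for exponents
    slightly above 1. *)
Lemma sum_prime_npow_unbounded (C sigma0 : R) : 1 < sigma0 ->
  exists2 s, s \in `]1, sigma0[ &
    exists N0, forall N, (N0 <= N)%N -> C < \sum_(0 <= p < N | prime p) npow s p.
Proof.
move=> s01; have [N0 hN0] := sum_prime_inv_unbounded C.
have c1 : \sum_(0 <= p < N0 | prime p) npow s p @[s --> 1^'+] -->
    \sum_(0 <= p < N0 | prime p) (p%:R^-1 : R).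
  under [X in _ --> X]eq_bigr => p pP do rewrite -npow1 ?prime_gt0//.
  apply: cvg_within_filter; elim: N0 {hN0} => [|N IH].
    by under eq_fun do rewrite big_geq//; rewrite big_geq//; exact: cvg_cst.
  rewrite big_mkcond big_nat_recr//= -big_mkcond.
  under eq_fun do rewrite big_mkcond big_nat_recr//= -big_mkcond.
  apply: cvgD => //; case: ifP => _; last exact: cvg_cst.
  exact: continuous_npow.
near (1 : R)^'+ => s; exists s.
  by rewrite in_itv/=; apply/andP; split; near: s;
    [exact: nbhs_right_gt|exact: nbhs_right_lt].
exists N0 => N NN.
have : C < \sum_(0 <= p < N0 | prime p) npow s p.
  by near: s; exact: (cvgr_gt _ c1).
move=> /lt_le_trans; apply.
rewrite (@big_cat_nat _ _ _ N0 0 N)//= lerDl sumr_ge0// => k _.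
exact: ltW (npow_gt0 _ _).
Unshelve. all: by end_near. Qed.

Lemma large_turn_dense (sigma0 C : R) : 1 < sigma0 ->
  exists s1 s2 : R, [/\ s1 \in `]1, sigma0[, s2 \in `]1, sigma0[ &
    relatively_dense [set t | C <= zeta_arg t s1 - zeta_arg t s2]].
Proof.
move=> s01; pose s2 := (1 + sigma0) / 2.
have s2I : s2 \in `]1, sigma0[ by rewrite in_itv/= /s2; apply/andP; split; lra.
have s21 : 1 < s2 by move: s2I; rewrite in_itv/= => /andP[].
pose Z := 6 * limn (series (npow (2 : R))) + 1.
(* [2 * Z] pays for the approximation errors at [s1] and [s2]. Below, [s1] is taken so near 1 that
   half the sum of the weights [npow s1 p - npow s2 p] exceeds [c]. *)
pose c := C + 2 * Z.
have [s1 s1I [N0 hN0]] := sum_prime_npow_unbounded (2 * c + limn (series (npow s2))) s01.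
have s11 : 1 < s1 by move: s1I; rewrite in_itv/= => /andP[].
have [N1 hN1] := zeta_arg_approx s11.
have [N2 hN2] := zeta_arg_approx s21.
pose N := maxn N0 (maxn N1 N2).
have NN0 : (N0 <= N)%N by rewrite leq_maxl.
have NN1 : (N1 <= N)%N by rewrite /N !leq_max leqnn !orbT.
have NN2 : (N2 <= N)%N by rewrite /N !leq_max leqnn !orbT.
exists s1, s2; split => //.
pose ps := [seq p <- index_iota 0 N | prime p].
have psP : all prime ps by exact: filter_all.
have ups : uniq ps by rewrite filter_uniq// iota_uniq.
have [|L L0 hL] := @sin_sum_large R ps (fun p => npow s1 p - npow s2 p) c psP ups.
  rewrite big_filter sumrB.
  have := hN0 N NN0; have := sum_prime_npow_le N s21; lra.
exists L => // a; have [t taL ht] := hL a; exists t; split => //=.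
have /ltr_normlW := hN2 N t NN2.
have := hN1 N t NN1; rewrite distrC => /ltr_normlW.
move: ht; rewrite big_filter /dominant -/Z.
under eq_bigr do rewrite mulrBl.
rewrite sumrB /c; lra.
Qed.

Lemma relatively_dense_sequence (T : set R) : relatively_dense T ->
  exists t : nat -> R, relatively_dense [set t m | m in [set m : nat | (1 <= m)%N]] /\
    forall m, T (t m).
Proof.
move=> [L L0 hT].
have /choice[f hf] : forall z : int, exists x, (`]z%:~R * L, z%:~R * L + L[ `&` T) x.
  by move=> z; have [x hx] := hT (z%:~R * L); exists x.
(* One point per cell of length [L], the cells being enumerated through codes of integers. [m.-1]
   starts the indexing at 1; a code of no integer falls back to cell 0. *)
exists (fun m => f (odflt 0 (unpickle m.-1))); split; last first.
  by move=> m; case: (hf (odflt 0 (unpickle m.-1))).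
exists (2 * L) => [|a]; first by rewrite mulr_gt0.
pose z := Num.ceil (a / L).
exists (f z); split; last by exists (pickle z).+1 => //=; rewrite pickleK.
have [/= + _] := hf z; rewrite !in_itv/= => /andP[z1 z2].
have := Num.Theory.ceil_ge (a / L); rewrite -/z ler_pdivrMr// => az.
(* The cell starts in [[a, a + L[], hence lies inside the interval of length [2 * L]. *)
have := Num.Theory.ceilB1_lt (a / L); rewrite -/z ltr_pdivlMr// rmorphB/= mulrBl mul1r => za.
apply/andP; split; lra.
Qed.

End Turns.

Theorem corollary3p9 (R : realType) (sigma0 : R) (n : nat)
    (sigma0_gt1 : 1 < sigma0) :
  exists t : nat -> R,
    relatively_dense [set t m | m in [set m : nat | (1 <= m)%N]] /\
    forall m : nat, (1 <= m)%N ->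
      makes_turns `]1, sigma0[ (fun sigma : R => zeta (sigma +i* t m)) n.
Proof.
have [s1 [s2 [s1I s2I /relatively_dense_sequence[t [td ht]]]]] :=
  large_turn_dense (2 * pi * n%:R) sigma0_gt1.
exists t; split=> // m _.
have I1 s : s \in `]1, sigma0[ -> 1 < s by rewrite in_itv/= => /andP[].
split=> [s /I1 s_gt1|s /I1 s_gt1|].
- exact: continuous_zeta.
- exact: (zeta_polar (t m) s_gt1).1.
exists (zeta_arg (t m)); split=> [s /I1 s_gt1|s /I1 s_gt1|].
- exact: continuous_zeta_arg.
- exact: (zeta_polar (t m) s_gt1).2.
by exists s1, s2; split => //; apply: le_trans (ht m) (ler_norm _).
Qed.
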